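(* Any local incremental topological ordering algorithm must, in the worst case, reorder $\Omega(n\sqrt{m})$ vertices, and hence must take $\Omega(n\sqrt{m})$ time. Precisely: there is an absolute constant $c>0$ such that for all positive integers $n'$, $m'$ with $n'\le m'\le\binom{n'}{2}$ there exist $n,m$ with $n'/c\le n\le cn'$ and $m'/c\le m\le cm'$, and a sequence of $m$ distinct arc additions to an initially arcless graph on $n$ vertices (with a given initial order) that keeps the graph acyclic, such that every local algorithm performs at least $n\sqrt{m}/c$ individual vertex moves on this sequence.
   Context: An incremental topological ordering algorithm maintains an explicit list of the vertices in an order that is topological for the current graph (every arc $(x,y)$ has $x$ before $y$) as arcs are added one at a time, and restores topological order when needed by moving one vertex at a time to a new position in the list. When an arc $(v,w)$ is added with $v$ after $w$ in the current order, the affected vertices are those between $w$ and $v$ inclusive in the current order. The algorithm is local if after each such addition it reorders only affected vertices (the affected vertices occupy the same interval of positions before and after, permuted so that the order becomes topological). Each vertex move costs at least unit time. The paper assumes $m=\Omega(n)$ arcs are added. *)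

(* Defs.v *)
From mathcomp Require Import all_boot all_order all_algebra.
From mathcomp Require Import reals.

Set Implicit Arguments.
Unset Strict Implicit.
Unset Printing Implicit Defensive.

Local Open Scope nat_scope.

(* The arc (x, y) goes from x to y; a graph on 'I_n is given by the sequence
   of arcs added so far to the arcless graph. *)
Notation arcT n := ('I_n * 'I_n)%type.

Section Orders.
Variable n : nat.
Implicit Types (L : seq 'I_n) (es : seq (arcT n)) (e : arcT n) (x : 'I_n).

(* In a vertex list L, the position of x is [index x L]. *)
Definition vertex_list L := perm_eq L (enum 'I_n).

Definition topological L es :=
  forall x y, (x, y) \in es -> index x L < index y L.

Definition acyclic es :=
  forall c : seq 'I_n, c != [::] -> ~~ cycle (fun x y => (x, y) \in es) c.

Definition keeps_acyclic es := forall k, acyclic (take k es).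

(* (x, p): take x out of the list and reinsert it so that its position is p
   (last position if p is too large). *)
Definition vmove := ('I_n * nat)%type.

Definition do_move L (mv : vmove) : seq 'I_n :=
  let L' := rem mv.1 L in take mv.2 L' ++ mv.1 :: drop mv.2 L'.

(* For e = (v, w): empty when v precedes w in L, so that a local algorithm
   makes no move when the current order is already topological. *)
Definition affected L e : {set 'I_n} :=
  [set x | index e.2 L <= index x L <= index e.1 L].

(* What an algorithm does in response to one arc addition. Each vertex move
   costs at least one unit of time. *)
Record response := Response {
  moves : seq vmove;
  time : nat;
  moves_le_time : size moves <= time }.

(* L is the order before the last arc e of [rcons es e] is added. *)
Definition local_step L es e (r : response) :=
  let L' := foldl do_move L (moves r) in
  [/\ forall mv, mv \in moves r -> mv.1 \in affected L e,
      forall x, x \in affected L e ->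
        index e.2 L <= index x L' <= index e.1 L
    & topological L' (rcons es e)].

End Orders.

(* An online algorithm: its response to an arc addition may depend on the
   initial list and on all the arcs added so far, the new one coming last. *)
Definition algorithm := forall n, seq 'I_n -> seq (arcT n) -> response n.

Section Runs.
Variables (A : algorithm) (n : nat) (L0 : seq 'I_n) (es : seq (arcT n)).

(* Response to the arc number k of es, counting from 0. *)
Definition step k : response n := A L0 (take k.+1 es).

(* The list after the first k arcs of es have been processed. *)
Fixpoint order_after k : seq 'I_n :=
  if k is k'.+1 then foldl (@do_move n) (order_after k') (moves (step k'))
  else L0.

Definition total_moves := \sum_(k < size es) size (moves (step k)).
Definition total_time := \sum_(k < size es) time (step k).

End Runs.

Definition local (A : algorithm) :=
  forall n (L0 : seq 'I_n) (es : seq (arcT n)) (e : arcT n),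
    vertex_list L0 -> uniq (rcons es e) -> keeps_acyclic (rcons es e) ->
    local_step (order_after A L0 es (size es)) es e (A n L0 (rcons es e)).

(* Main.v *)
(* Cut the list into [k] blocks of [s] consecutive vertices, where [k] is about
   [sqrt m'] and [k * s] about [n']. First make each block a path, which
   displaces nothing; then, as in insertion sort, bring the blocks into reverse
   order by swapping adjacent ones, a swap being triggered by an arc from the
   last vertex of the right block to the first vertex of the left one. The
   affected vertices are then exactly the two blocks, and the new order is forced,
   so every local algorithm goes through the same lists. An unmoved vertex
   of the left block and an unmoved vertex of the right block would keep their
   order, so one of the blocks is moved entirely: each of the [k(k-1)/2] swaps
   takes at least [s] moves. *)
Require Import Defs.
From mathcomp Require Import all_boot all_order all_algebra.
From mathcomp Require Import reals zify.
Import Order.TTheory GRing.Theory Num.Theory.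
Set Implicit Arguments.
Unset Strict Implicit.
Unset Printing Implicit Defensive.
Local Open Scope nat_scope.

(** * Vertex moves, and what locality forces in one step *)

Section Moves.
Variable n : nat.
Implicit Types (L P Q M : seq 'I_n) (mvs : seq (vmove n)).

Lemma perm_do_move L (mv : vmove n) : mv.1 \in L -> perm_eq (do_move L mv) L.
Proof.
move=> mvL; rewrite /do_move perm_catC /= perm_sym.
apply: perm_trans (perm_to_rem mvL) _.
by rewrite perm_cons perm_sym perm_catC cat_take_drop.
Qed.

Lemma perm_do_moves L mvs :
  vertex_list L -> perm_eq (foldl (@do_move n) L mvs) L.
Proof.
elim: mvs L => //= mv mvs IH L VL.
have pL : perm_eq (do_move L mv) L.
  by apply: perm_do_move; rewrite (perm_mem VL) mem_enum.
by apply: perm_trans (IH _ (perm_trans pL VL)) pL.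
Qed.

Lemma filter_do_moves (p : pred 'I_n) L mvs :
    (forall mv, mv \in mvs -> ~~ p mv.1) ->
  filter p (foldl (@do_move n) L mvs) = filter p L.
Proof.
elim: mvs L => //= mv mvs IH L npmvs; rewrite IH => [|mv' mv'P]; last first.
  by apply: npmvs; rewrite inE mv'P orbT.
have /negbTE npmv := npmvs mv (mem_head _ _).
rewrite /do_move filter_cat /= npmv -filter_cat cat_take_drop.
elim: L => //= x L IHL; case: eqP => [-> | _] /=; first by rewrite npmv.
by rewrite IHL.
Qed.

Lemma mem_middle P M Q x : uniq (P ++ M ++ Q) ->
  (x \in M) = (size P <= index x (P ++ M ++ Q) < size P + size M).
Proof.
rewrite cat_uniq => /and3P[_ /hasPn dP _]; rewrite !index_cat.
case: ifP => xP.
  rewrite leqNgt index_mem xP /=; apply/negP => xM.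
  by have := dP x; rewrite mem_cat xM xP => /(_ isT).
rewrite leq_addr ltn_add2l /=.
by case: ifP => xM; rewrite ?index_mem // ltnNge leq_addr.
Qed.

(** The arc runs from the last to the first vertex of the segment [w :: M], so this segment is the
    affected set. Locality keeps its vertices in the same positions, and the others, being unmoved,
    keep their relative order; hence [P] and [Q] survive. *)
Lemma local_step_middle P M Q v w es (r : response n) :
    vertex_list (P ++ (w :: M) ++ Q) -> last w M = v ->
    local_step (P ++ (w :: M) ++ Q) es (v, w) r ->
  (forall mv, mv \in moves r -> mv.1 \in w :: M) /\
  exists2 M', perm_eq M' (w :: M)
    & foldl (@do_move n) (P ++ (w :: M) ++ Q) (moves r) = P ++ M' ++ Q.
Proof.
move=> VL lastM [mvA affA _].
set L := P ++ _ ++ _ in VL mvA affA *.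
have uL : uniq L by rewrite (perm_uniq VL) enum_uniq.
have iw : index w L = size P.
  have := uL; rewrite cat_uniq => /and3P[_ /hasPn dP _].
  rewrite index_cat ifN; first by rewrite /= eqxx addn0.
  by apply: dP; rewrite mem_head.
have iv : index v L = size P + size M.
  have := uL; rewrite cat_uniq => /and3P[_ /hasPn dP].
  rewrite cat_uniq => /and3P[uM _ _].
  rewrite index_cat ifN; last by apply: dP; rewrite mem_cat -lastM mem_last.
  by rewrite index_cat -lastM mem_last index_last.
have affE x : (x \in affected L (v, w)) = (x \in w :: M).
  by rewrite inE (mem_middle _ uL) /= iw iv addnS ltnS.
split=> [mv /mvA|]; first by rewrite affE.
set L' := foldl _ _ _ in affA *.
have pL : perm_eq L' L by apply: perm_do_moves.
have uL' : uniq L' by rewrite (perm_uniq pL).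
pose p := [pred x | x \notin w :: M].
have fL' : filter p L' = filter p L.
  by apply: filter_do_moves => mv /mvA; rewrite affE /= negbK.
have fL : filter p L = P ++ Q.
  have := uL; rewrite /L uniq_catCA cat_uniq => /and3P[_ /hasPn dM _].
  rewrite !filter_cat (eq_in_filter (a2 := pred0) (s := w :: M)) => [|x /= ->] //.
  rewrite filter_pred0.
  by congr (_ ++ _); apply/all_filterP/allP => x xP; apply: dM; rewrite mem_cat xP ?orbT.
have sL' : size L' = size P + ((size M).+1 + size Q).
  by rewrite (perm_size pL) !size_cat.
(* The new list is cut at the old positions. [Y] contains [w :: M] by locality and has the same
   size, so it is a permutation of it. *)
pose X := take (size P) L'; pose Y := take (size M).+1 (drop (size P) L').
pose Z := drop (size M).+1 (drop (size P) L').
have L'E : L' = X ++ Y ++ Z by rewrite /X /Y /Z !cat_take_drop.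
have sX : size X = size P by rewrite size_takel // sL' leq_addr.
have sY : size Y = (size M).+1 by rewrite size_takel // size_drop sL' addKn leq_addr.
have sZ : size Z = size Q by rewrite !size_drop sL' !addKn.
have uXYZ : uniq (X ++ Y ++ Z) by rewrite -L'E.
have MY : {subset w :: M <= Y}.
  move=> x; rewrite -affE => /affA; rewrite /= iw iv //.
  by rewrite (mem_middle x uXYZ) sX sY -L'E addnS ltnS.
have uM : uniq (w :: M).
  by have := uL; rewrite /L uniq_catCA cat_uniq => /andP[].
have [|_ MYi] := uniq_min_size uM MY; first by rewrite sY.
have uY : uniq Y by have := uL'; rewrite L'E uniq_catCA cat_uniq => /andP[].
have pY : perm_eq Y (w :: M) by apply: uniq_perm => // x; rewrite MYi.
exists Y => //; rewrite L'E.
have : filter p L' = X ++ Z.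
  have := uL'; rewrite L'E uniq_catCA cat_uniq => /and3P[_ /hasPn dM _].
  rewrite !filter_cat (eq_in_filter (a2 := pred0) (s := Y)) => [|x] /=; last first.
    by rewrite MYi => ->.
  rewrite filter_pred0.
  by congr (_ ++ _); apply/all_filterP/allP => x xP; rewrite /= MYi; apply: dM; rewrite mem_cat xP ?orbT.
rewrite fL' fL => /eqP; rewrite eqseq_cat ?sX // => /andP[/eqP-> /eqP->] //.
Qed.

(** The two paths and the new arc form a single path through [Y] and then [X] that visits every
    affected vertex, so only one topological order of these vertices exists. *)
Lemma swap_blocks P X Y Q v w es (r : response n) :
    vertex_list (P ++ X ++ Y ++ Q) -> X != [::] -> Y != [::] ->
    head w X = w -> last v Y = v ->
    sorted (fun x y => (x, y) \in es) X -> sorted (fun x y => (x, y) \in es) Y ->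
    local_step (P ++ X ++ Y ++ Q) es (v, w) r ->
  foldl (@do_move n) (P ++ X ++ Y ++ Q) (moves r) = P ++ Y ++ X ++ Q /\
  minn (size X) (size Y) <= size (moves r).
Proof.
case: X Y => [|x X] // [|y Y] // VL _ _ /= xw lastY; subst x.
move=> sX sY ls.
have uL : uniq (P ++ (w :: X) ++ (y :: Y) ++ Q) by rewrite (perm_uniq VL) enum_uniq.
have E : P ++ (w :: X) ++ (y :: Y) ++ Q = P ++ (w :: (X ++ y :: Y)) ++ Q.
  by rewrite /= -!catA.
have [] := @local_step_middle P (X ++ y :: Y) Q v w es r.
- by rewrite -E.
- by rewrite last_cat /=.
- by rewrite -E.
rewrite -E => mvM [M' pM' L'E].
case: ls => _ _ topL'.
have uM : uniq (w :: X ++ y :: Y) by have := uL; rewrite E uniq_catCA cat_uniq => /andP[].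
have uM' : uniq M' by rewrite (perm_uniq pM').
have pL' := perm_do_moves (moves r) VL.
set L' := foldl _ _ _ in L'E topL' pL' *.
have uL' : uniq L' by rewrite (perm_uniq pL').
pose lt x y := index x L' < index y L'.
have ltT : transitive lt by move=> a b c; apply: ltn_trans.
have irr : irreflexive lt by move=> a; rewrite /lt ltnn.
have sortL' : sorted lt L'.
  rewrite (sorted_pairwise ltT); apply/(pairwiseP w) => a b.
  by rewrite !inE => al bl ab; rewrite /lt !index_uniq.
have M'E : M' = (y :: Y) ++ (w :: X).
  apply: (irr_sorted_eq ltT irr).
  - move: sortL'; rewrite L'E !(sorted_pairwise ltT) !pairwise_cat.
    by case/and3P=> _ _ /and3P[].
  - have sub a b : (a, b) \in es -> lt a b.
      by move=> ab; apply: topL'; rewrite mem_rcons inE ab orbT.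
    rewrite /= cat_path; apply/andP; split; first exact: sub_path sY.
    rewrite /= lastY; apply/andP; split; last exact: sub_path sX.
    by apply: topL'; rewrite mem_rcons mem_head.
  - by move=> a; rewrite (perm_mem pM') -cat_cons !mem_cat orbC.
split; first by rewrite L'E M'E -catA.
(* With fewer moves, both blocks would contain an unmoved vertex. *)
rewrite leqNgt; apply/negP; rewrite ltn_min => /andP[ltX ltY].
pose S := [seq mv.1 | mv <- moves r].
pose p := [pred x | x \notin S].
have hasp (Z : seq 'I_n) : uniq Z -> size (moves r) < size Z -> has p Z.
  move=> uZ; apply: contraTT; rewrite -leqNgt -(size_map fst (moves r)) => /hasPn ZS.
  by apply: uniq_leq_size => // z /ZS /=; rewrite negbK.
have : filter p L' = filter p (P ++ (w :: X) ++ (y :: Y) ++ Q).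
  by apply: filter_do_moves => mv mvr; rewrite /= negbK; apply: map_f.
rewrite L'E M'E.
(* Once the parts from [P] and [Q] are split off, the first unmoved vertex of [Y] equals the first
   unmoved vertex of [X], although the blocks are disjoint. *)
rewrite -catA !(filter_cat p) => /eqP; rewrite eqseq_cat // eqxx /= !catA eqseq_cat; last first.
  by rewrite !size_cat addnC.
have := uM; rewrite -cat_cons cat_uniq => /and3P[uX /hasPn dXY uY].
have:= hasp _ uX ltX; have := hasp _ uY ltY; rewrite !has_filter.
rewrite -!/(filter p (_ :: _)).
case EX: (filter p (w :: X)) => [|x' X'] //; case EY: (filter p (y :: Y)) => [|y' Y'] // _ _.
case/andP=> /eqP[yx _] _.
have y'Y : y' \in y :: Y by have := mem_head y' Y'; rewrite -EY mem_filter => /andP[].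
have x'X : x' \in w :: X by have := mem_head x' X'; rewrite -EX mem_filter => /andP[].
by have := dXY _ y'Y; rewrite yx x'X.
Qed.

End Moves.

(** * Extending a run by one arc *)

Section RunPrefix.
Variables (A : algorithm) (n : nat) (L0 : seq 'I_n).
Implicit Types (es : seq (arcT n)).

Lemma order_after_prefix es es' k :
  k <= size es -> order_after A L0 (es ++ es') k = order_after A L0 es k.
Proof.
elim: k => //= k IH lk; rewrite IH ?(ltnW lk) //.
by rewrite /step takel_cat.
Qed.

Definition final_order es := order_after A L0 es (size es).

Lemma final_order_rcons es e :
  final_order (rcons es e)
  = foldl (@do_move n) (final_order es) (moves (A L0 (rcons es e))).
Proof.
rewrite /final_order size_rcons /= -cats1 order_after_prefix //.
by rewrite /step take_oversize // size_cat addn1.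
Qed.

Lemma total_moves_rcons es e :
  total_moves A L0 (rcons es e)
  = total_moves A L0 es + size (moves (A L0 (rcons es e))).
Proof.
rewrite /total_moves size_rcons big_ord_recr /= -cats1; congr (_ + _).
  by apply: eq_bigr => i _; rewrite /step takel_cat.
by rewrite /step take_oversize // size_cat addn1.
Qed.

Lemma total_moves_le_time es : total_moves A L0 es <= total_time A L0 es.
Proof. by apply: leq_sum => k _; apply: moves_le_time. Qed.

End RunPrefix.

(** Going around a cycle would increase the rank strictly. *)
Lemma ranked_keeps_acyclic n (rk : 'I_n -> nat) (es : seq (arcT n)) :
  {in es, forall e, rk e.1 < rk e.2} -> keeps_acyclic es.
Proof.
move=> rkP k [|x c] // _; apply/negP.
have sub : subrel (fun x y => (x, y) \in take k es) (fun x y => rk x < rk y).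
  by move=> a b /mem_take /rkP.
move=> /= /(sub_path sub).
have T : transitive (fun x y => rk x < rk y) by move=> a b d; apply: ltn_trans.
by move/(order_path_min T)/allP/(_ x); rewrite mem_rcons mem_head ltnn => /(_ isT).
Qed.

(** * The hard arc sequence *)

Section Construction.
Variables (k s n : nat).
Hypotheses (s_gt0 : 0 < s) (nE : n.+1 = k * s).

Local Notation v := (@inord n).
Definition first b := v (b * s).
Definition final b := v (b * s + s.-1).
Definition block b := [seq v t | t <- iota (b * s) s].
Definition order_of (bs : seq nat) := flatten [seq block b | b <- bs].

(** The filter drops the last vertex of each block, in particular the last vertex of all, so [inord]
    never falls back on its default value. *)
Definition path_arcs : seq (arcT n.+1) :=
  [seq (x, v x.+1) | x : 'I_n.+1 <- enum 'I_n.+1 & x.+1 %% s != 0].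
Definition back_arc (ji : nat * nat) : arcT n.+1 := (final ji.1, first ji.2).
(** The order of enumeration matters: when stage [j] begins, the blocks before [j] read
    [j - 1, ..., 0], so block [j] meets [0, 1, ...] in turn on its way to the left. *)
Definition back_pairs := [seq (j, i) | j <- iota 0 k, i <- iota 0 j].
Definition hard_arcs := path_arcs ++ [seq back_arc ji | ji <- back_pairs].

Lemma block_bound b t : b < k -> t < s -> b * s + t < n.+1.
Proof. by rewrite nE; nia. Qed.

Lemma back_pairsP j i : reflect (i < j < k) ((j, i) \in back_pairs).
Proof.
apply: (iffP allpairsPdep) => [[j' [i' []]]|/andP[ij jk]].
  by rewrite !mem_iota !add0n /= => jk ij [-> ->]; rewrite ij.
by exists j, i; rewrite !mem_iota !add0n.
Qed.

Lemma uniq_back_pairs : uniq back_pairs.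
Proof.
apply: allpairs_uniq_dep => [|j _|[j i] [j' i'] _ _ /= [-> ->]] //; exact: iota_uniq.
Qed.

Lemma size_back_pairs : size back_pairs = 'C(k, 2).
Proof.
rewrite size_allpairs_dep sumnE big_map -bin2_sum.
by rewrite -{1}(subn0 k) -/(index_iota 0 k); apply: eq_bigr => j _; rewrite size_iota.
Qed.

(** Up to a shift by [s], the position of [x] once the blocks are in reverse order; this order is
    topological for the whole sequence. *)
Definition rank (x : 'I_n.+1) := (k - x %/ s) * s + x %% s.

Lemma first_blk b : b < k -> first b %/ s = b /\ first b %% s = 0.
Proof.
move=> bk; have := block_bound bk s_gt0; rewrite addn0 => lt.
by rewrite /first inordK // mulnK // modnMl.
Qed.

Lemma final_blk b : b < k -> final b %/ s = b /\ final b %% s = s.-1.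
Proof.
move=> bk; have lt : s.-1 < s by rewrite prednK.
rewrite /final inordK ?block_bound //.
by rewrite divnMDl // modnMDl divn_small // modn_small // addn0.
Qed.

Lemma path_arc_blk e : e \in path_arcs ->
  [/\ e.2 = e.1.+1 :> nat, e.1 %/ s = e.2 %/ s & e.2 %% s = (e.1 %% s).+1].
Proof.
case/mapP=> x; rewrite mem_filter => /andP[xs _] -> /=.
have lt : (x %% s).+1 < s.
  have := ltn_pmod x s_gt0; rewrite leq_eqVlt => /orP[/eqP xE|//].
  by move: xs; rewrite -addn1 -modnDml addn1 xE modnn.
have xE : x.+1 = x %/ s * s + (x %% s).+1 by rewrite addnS -divn_eq.
have xk : x %/ s < k by rewrite ltn_divLR // -nE.
rewrite inordK; last by rewrite xE block_bound.
split=> //; rewrite xE; last by rewrite modnMDl [RHS]/= (modn_small lt).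
by rewrite divnMDl // (divn_small lt) addn0.
Qed.

Lemma hard_arcs_ranked : {in hard_arcs, forall e, rank e.1 < rank e.2}.
Proof.
move=> e; rewrite mem_cat /rank => /orP[/path_arc_blk[_ -> ->]|].
  by rewrite addnS ltnS.
case/mapP=> -[j i] /back_pairsP/andP[ij jk] -> /=.
have [-> ->] := final_blk jk; have [-> ->] := first_blk (ltn_trans ij jk).
by rewrite addn0; nia.
Qed.

Lemma hard_arcs_acyclic : keeps_acyclic hard_arcs.
Proof. exact: ranked_keeps_acyclic hard_arcs_ranked. Qed.

(** A path arc stays inside one block, while a back arc joins two different blocks and is determined
    by their numbers. *)
Lemma uniq_hard_arcs : uniq hard_arcs.
Proof.
rewrite cat_uniq; apply/and3P; split.
- rewrite map_inj_uniq => [|x y [] //].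
  exact: filter_uniq (enum_uniq _).
- apply/hasPn => _ /mapP[[j i] /back_pairsP/andP[ij jk] ->].
  apply/negP => /path_arc_blk[_ /= + _].
  have [-> _] := final_blk jk; have [-> _] := first_blk (ltn_trans ij jk).
  by move=> ji; rewrite ji ltnn in ij.
- rewrite map_inj_in_uniq ?uniq_back_pairs // => -[j i] [j' i'].
  move=> /back_pairsP/andP[ij jk] /back_pairsP/andP[ij' jk'] [fjj fii].
  have [bj _] := final_blk jk; have [bi _] := first_blk (ltn_trans ij jk).
  have [bj' _] := final_blk jk'; have [bi' _] := first_blk (ltn_trans ij' jk').
  by rewrite -bj -bi fjj fii bj' bi'.
Qed.

Lemma size_hard_arcs : 'C(k, 2) <= size hard_arcs <= n.+1 + 'C(k, 2).
Proof.
rewrite size_cat !size_map size_back_pairs leq_addl leq_add2r.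
by rewrite size_filter (leq_trans (count_size _ _)) // size_enum_ord.
Qed.

Lemma size_block b : size (block b) = s.
Proof. by rewrite size_map size_iota. Qed.

Lemma order_of_iota : order_of (iota 0 k) = enum 'I_n.+1.
Proof.
have E m : order_of (iota 0 m) = [seq v t | t <- iota 0 (m * s)].
  elim: m => // m IH; rewrite -[m.+1]addn1 iotaD add0n /order_of map_cat flatten_cat.
  rewrite -/(order_of _) IH /= cats0 mulnDl mul1n iotaD map_cat add0n.
  by [].
rewrite E -nE; apply: (inj_map val_inj); rewrite val_enum_ord -map_comp.
rewrite -[RHS]map_id; apply/eq_in_map => t; rewrite mem_iota add0n => /= lt.
by rewrite inordK.
Qed.

Lemma block_sorted b : b < k -> sorted (fun x y => (x, y) \in path_arcs) (block b).
Proof.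
move=> bk; rewrite /block -(addn0 (b * s)) iotaDl -map_comp.
apply/(sortedP (v 0)) => t; rewrite size_map size_iota => lt.
rewrite !(nth_map 0) ?size_iota ?(ltnW lt) // !nth_iota ?(ltnW lt) //= !add0n.
apply/mapP; exists (v (b * s + t)).
  rewrite mem_filter mem_enum andbT inordK ?block_bound ?(ltnW lt) //.
  by rewrite -addnS modnMDl modn_small.
by rewrite inordK ?block_bound ?(ltnW lt) // addnS.
Qed.

(** * The run of a local algorithm on the hard sequence *)

Section Run.
Variable A : algorithm.
Hypothesis locA : local A.
Let L0 := order_of (iota 0 k).

Lemma vertex_list_order_of bs : perm_eq bs (iota 0 k) -> vertex_list (order_of bs).
Proof.
move=> pbs; rewrite /vertex_list -order_of_iota.
by apply: perm_flatten; apply: perm_map.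
Qed.

Lemma hard_local_step es e es' : hard_arcs = es ++ e :: es' ->
  local_step (final_order A L0 es) es e (A L0 (rcons es e)).
Proof.
rewrite -cat_rcons => E; apply: locA; first exact: vertex_list_order_of.
  by have := uniq_hard_arcs; rewrite E cat_uniq => /and3P[].
apply: (@ranked_keeps_acyclic _ rank) => x xe; apply: hard_arcs_ranked.
by rewrite E mem_cat xe.
Qed.

(** Each path arc agrees with the initial order, so its affected set is empty and no move is
    allowed. *)
Lemma final_order_path_arcs es es' : path_arcs = es ++ es' -> final_order A L0 es = L0.
Proof.
elim/last_ind: es es' => [//|es e IH] es'; rewrite cat_rcons => E.
have [|mvA _ _] := @hard_local_step es e (es' ++ [seq back_arc ji | ji <- back_pairs]).
  by rewrite /hard_arcs E -catA.
rewrite final_order_rcons (IH _ E) in mvA *.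
have ep : e \in path_arcs by rewrite E mem_cat mem_head orbT.
have lte : index e.1 L0 < index e.2 L0.
  by rewrite /L0 order_of_iota !index_enum_ord; have [-> _ _] := path_arc_blk ep.
case: (moves _) mvA => [|mv mvs] // /(_ mv (mem_head _ _)).
by rewrite inE => /andP[le1 le2]; have := leq_trans le1 le2; rewrite leqNgt lte.
Qed.

(** This is [swap_blocks] lifted to lists of blocks. Having all path arcs in [es] makes both blocks
    paths, and their common size [s] is the bound on the moves. *)
Lemma back_arc_step es j i P Q es' :
    {subset path_arcs <= es} -> i < k -> j < k ->
    hard_arcs = es ++ back_arc (j, i) :: es' ->
    perm_eq (P ++ i :: j :: Q) (iota 0 k) ->
    final_order A L0 es = order_of (P ++ i :: j :: Q) ->
  final_order A L0 (rcons es (back_arc (j, i))) = order_of (P ++ j :: i :: Q) /\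
  s <= size (moves (A L0 (rcons es (back_arc (j, i))))).
Proof.
move=> sub ik jk E pbs FO; have := hard_local_step E.
rewrite final_order_rcons FO.
have OE b b' :
    order_of (P ++ b :: b' :: Q) = order_of P ++ block b ++ block b' ++ order_of Q.
  by rewrite /order_of map_cat flatten_cat.
rewrite !OE => ls; have VL := vertex_list_order_of pbs; rewrite OE in VL.
have nz b : block b != [::] by rewrite -size_eq0 size_block -lt0n.
have srt b : b < k -> sorted (fun x y => (x, y) \in es) (block b).
  by move=> bk; apply: sub_sorted (block_sorted bk) => x y; apply: sub.
rewrite -[X in X <= _](minnn s) -{1}(size_block i) -{1}(size_block j).
apply: (swap_blocks VL _ _ _ _ _ _ ls) => //.
- by rewrite /block -{2}(prednK s_gt0).
- by rewrite /block -{2}(prednK s_gt0) -[s.-1.+1]addn1 iotaD map_cat last_cat.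
- exact: srt.
- exact: srt.
Qed.

(** For [i < j < k], the prefix of [back_pairs] that stops just before [(j, i)]. The value [i = j]
    marks the end of stage [j], which is also the start of stage [j + 1]. *)
Let pairs_before j i :=
  [seq (j', i') | j' <- iota 0 j, i' <- iota 0 j'] ++ [seq (j, i') | i' <- iota 0 i].
Let arcs_before j i := path_arcs ++ [seq back_arc ji | ji <- pairs_before j i].

Lemma arcs_beforeS j i : arcs_before j i.+1 = rcons (arcs_before j i) (back_arc (j, i)).
Proof.
by rewrite /arcs_before /pairs_before -[i.+1]addn1 iotaD add0n !map_cat -cats1 -!catA.
Qed.

Lemma arcs_before_stage j : arcs_before j.+1 0 = arcs_before j j.
Proof.
rewrite /arcs_before /pairs_before cats0 -[j.+1]addn1 iotaD add0n.
by rewrite map_cat flatten_cat /= cats0.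
Qed.

Lemma arcs_before_prefix j i : i <= j < k -> exists es', hard_arcs = arcs_before j i ++ es'.
Proof.
case/andP=> ij jk.
have -> : hard_arcs = arcs_before k 0 by rewrite /arcs_before /pairs_before cats0.
(* Induction on the number of stages after [j], each appended pair by pair; the base case completes
   stage [j] from [i] on. *)
rewrite -(subnKC jk); elim: (k - _) => [|d [es' IH]]; last first.
  rewrite addnS arcs_before_stage.
  suff [es2 ->] : exists es2, arcs_before (j.+1 + d) (j.+1 + d) = arcs_before (j.+1 + d) 0 ++ es2.
    by exists (es' ++ es2); rewrite IH catA.
  elim: {2}(j.+1 + d) => [|m [es2 IHm]]; first by exists [::]; rewrite cats0.
  by exists (rcons es2 (back_arc (j.+1 + d, m))); rewrite arcs_beforeS IHm rcons_cat.
rewrite addn0 arcs_before_stage -{2}(subnKC ij).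
elim: (j - i) => [|d [es' IH]]; first by exists [::]; rewrite addn0 cats0.
by exists (rcons es' (back_arc (j, i + d))); rewrite addnS arcs_beforeS IH rcons_cat.
Qed.

(* During stage [j], block [j] has been moved in front of the blocks
   [0], ..., [i - 1], which the earlier stages have put in reverse order. *)
Let blocks_at j i :=
  rev (iota i (j - i)) ++ j :: rev (iota 0 i) ++ iota j.+1 (k - j.+1).

Lemma rev_iotaS m : rev (iota 0 m.+1) = m :: rev (iota 0 m).
Proof. by rewrite -addn1 iotaD rev_cat. Qed.

(** The number ['C(j, 2) + i] counts the swaps made so far, each of which costs at least [s]
    moves. *)
Lemma run_invariant j i : i <= j < k ->
  [/\ final_order A L0 (arcs_before j i) = order_of (blocks_at j i),
      perm_eq (blocks_at j i) (iota 0 k)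
    & s * ('C(j, 2) + i) <= total_moves A L0 (arcs_before j i)].
Proof.
elim: j i => [|j IHj].
  case=> // /= k0; split; rewrite ?muln0 //.
    rewrite /arcs_before cats0 (@final_order_path_arcs _ [::]) ?cats0 //.
    by rewrite /L0 /blocks_at /= -(prednK k0) subn1.
  by rewrite /blocks_at /= -{2}(prednK k0) subn1.
elim=> [|i IHi] /andP[ij jk].
  have [|FO pbs tm] := IHj j; first by rewrite leqnn ltnW.
  (* Passing to the next stage changes neither the arcs nor the list, and the two counts agree by
     Pascal's rule. *)
  have <- : blocks_at j j = blocks_at j.+1 0.
    by rewrite /blocks_at subnn subn0 rev_iotaS -(subnSK jk).
  by rewrite arcs_before_stage binS bin1 addn0; split.
have [|FO pbs tm] := IHi; first by rewrite jk ltnW.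
have eq1 : blocks_at j.+1 i =
    rev (iota i.+1 (j - i)) ++ i :: j.+1 :: rev (iota 0 i) ++ iota j.+2 (k - j.+2).
  by rewrite /blocks_at subSn //= rev_cons cat_rcons.
have eq2 : blocks_at j.+1 i.+1 =
    rev (iota i.+1 (j - i)) ++ j.+1 :: i :: rev (iota 0 i) ++ iota j.+2 (k - j.+2).
  by rewrite /blocks_at subSS rev_iotaS.
have [|es' E] := @arcs_before_prefix j.+1 i.+1; first by rewrite ij.
rewrite arcs_beforeS cat_rcons in E.
have ik : i < k by apply: leq_trans ij (ltnW jk).
rewrite eq1 in FO pbs.
have [|FO' mv] := back_arc_step _ ik jk E pbs FO.
  by move=> e ep; rewrite mem_cat ep.
rewrite arcs_beforeS eq2; split=> //.
  apply: perm_trans pbs; rewrite perm_cat2l.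
  by rewrite (perm_catCA [:: j.+1] [:: i]).
by rewrite total_moves_rcons addnS mulnSr leq_add.
Qed.

Lemma hard_arcs_moves : s * 'C(k, 2) <= total_moves A L0 hard_arcs.
Proof.
have k_gt0 : 0 < k by rewrite lt0n; apply: contra_eq_neq nE => ->.
(* The invariant requires [j < k], so the end of the run is reached as the end of stage [k - 1]. *)
have [|_ _] := @run_invariant k.-1 k.-1; first by rewrite leqnn /= prednK.
rewrite -arcs_before_stage prednK // /arcs_before /pairs_before cats0.
suff -> : 'C(k, 2) = 'C(k.-1, 2) + k.-1 by [].
by rewrite -{1}(prednK k_gt0) binS bin1.
Qed.

End Run.
End Construction.

(** * Choice of parameters and the final estimates *)

Local Open Scope ring_scope.

Theorem theorem4p7 (R : realType) :
  exists c : R, 0 < c /\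
    forall n' m' : nat, (0 < n')%N -> (0 < m')%N ->
      (n' <= m')%N -> (m' <= 'C(n', 2))%N ->
      exists n m : nat,
        [/\ n'%:R / c <= n%:R <= c * n'%:R,
            m'%:R / c <= m%:R <= c * m'%:R
          & exists (L0 : seq 'I_n) (es : seq (arcT n)),
            [/\ vertex_list L0, size es = m, uniq es, keeps_acyclic es
              & forall A : algorithm, local A ->
                  n%:R * Num.sqrt m%:R / c <= (total_moves A L0 es)%:R /\
                  n%:R * Num.sqrt m%:R / c <= (total_time A L0 es)%:R ]].
Proof.
(* The constant leaves slack: the estimates below give factors 2 for [n], 4 for [m] and 8 for the
   moves. *)
exists 16; split=> // n' m' n'_gt0 m'_gt0 n'm' m'n'.
have [f fm' m'f] : exists2 f, (f ^ 2 <= m')%N & (m' < f.+1 ^ 2)%N.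
  have ex0 : exists f, (f ^ 2 <= m')%N by exists 0%N.
  have bnd f : (f ^ 2 <= m')%N -> (f <= m')%N by rewrite -mulnn; nia.
  case: (ex_maxnP ex0 bnd) => f fm' maxf; exists f => //.
  by rewrite ltnNge; apply/negP => /maxf; rewrite ltnn.
have bin2E q : (2 * 'C(q, 2) = q * q.-1)%N.
  by rewrite bin2 mul2n -[RHS]odd_double_half oddM; case: q => //= q; rewrite andNb.
have f_gt0 : (0 < f)%N.
  rewrite lt0n; apply: contraTN m'f => /eqP->; rewrite -leqNgt.
  exact: leq_trans n'_gt0 n'm'.
(* From [f^2 <= m' <= 'C(n', 2) < n'^2]. It gives [k <= n'], so rounding [n'] up to a multiple of
   [k] at most doubles it. *)
have fn' : (f < n')%N.
  rewrite -ltn_sqr (leq_ltn_trans (leq_trans fm' m'n')) //.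
  rewrite -(ltn_pmul2l (isT : 0 < 2)%N) bin2E -mulnn mulnCA ltn_pmul2l //.
  lia.
pose k := f.+1; pose s := (n' %/ k).+1.
have nE : (k * s).-1.+1 = (k * s)%N by rewrite prednK.
have /andP[n'n nn'] : (n' <= k * s <= 2 * n')%N.
  have := divn_eq n' k; have := ltn_pmod n' (isT : 0 < k)%N.
  by rewrite /s mulnS [(k * _)%N]mulnC; lia.
have bk : (2 * 'C(k, 2) = k * f)%N := bin2E k.
have kf : (k * k <= 2 * (k * f))%N by rewrite mulnCA leq_pmul2l // /k; lia.
have kf' : (k * f <= 2 * m')%N.
  by rewrite (leq_trans (n := (2 * f) * f)) ?leq_pmul2r // -?mulnA ?leq_pmul2l //; rewrite /k; lia.
rewrite -mulnn -/k in m'f.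
have /andP[] := @size_hard_arcs k s (k * s).-1.
set es := hard_arcs k s _ => mlo; rewrite [X in (X + _)%N]nE => mhi.
(* Lower bound: [m' < k^2 <= 2kf = 4 'C(k, 2)]. Upper bound: [size es <= ks + 'C(k, 2) <= 2n' + m'
   <= 3m']. *)
have lo : (m' <= 16 * size es)%N by lia.
have hi : (size es <= 16 * m')%N by lia.
pose n := (k * s).-1.+1.
exists n, (size es).
have cS (a b : nat) : (a <= 16 * b)%N -> a%:R / 16 <= b%:R :> R.
  by move=> ab; rewrite ler_pdivrMr // mulrC -natrM ler_nat.
have key a : (s * 'C(k, 2) <= a)%N -> n%:R * Num.sqrt (size es)%:R / 16 <= a%:R :> R.
  (* The square root is at most [2k], since [size es <= 3m' <= 4k^2]; then
     [n * 2k = 2sk^2 <= 4skf = 8s 'C(k, 2)]. *)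
  move=> sa; apply: (@le_trans _ _ (n%:R * (2 * k)%:R / 16)).
    rewrite ler_wpM2r ?invr_ge0 // ler_wpM2l // -[leRHS]ger0_norm // -sqrtr_sqr ler_wsqrtr //.
    rewrite -natrX ler_nat -mulnn mulnACA; lia.
  rewrite -natrM cS // /n nE; apply: leq_trans (leq_mul (leqnn 16) sa).
  have -> : (k * s * (2 * k) = 2 * s * (k * k))%N by lia.
  have -> : (16 * (s * 'C(k, 2)) = 2 * s * (4 * (k * f)))%N by rewrite -bk; lia.
  by rewrite leq_mul //; lia.
split; last exists (order_of s _ (iota 0 k)), es.
- rewrite cS /=; last by rewrite /n nE; lia.
  by rewrite -natrM ler_nat /n nE; lia.
- by rewrite cS //= -natrM ler_nat.
- split=> //.
  + exact: vertex_list_order_of nE _ (perm_refl _).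
  + exact: (uniq_hard_arcs _ nE).
  + exact: (hard_arcs_acyclic _ nE).
  move=> A locA; have hm := hard_arcs_moves _ nE locA.
  split; apply: key; first exact: hm.
  exact: leq_trans (hm _) (total_moves_le_time _ _ _).
Qed.
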